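(* There is an absolute constant $K>0$ such that the following holds. Let $p,\varepsilon,\delta\in(0,1)$ and $t\ge K\log(1/\delta)/(p\varepsilon)^4$. Let $\mathbf{x}_1,\dots,\mathbf{x}_t\sim\mathcal{D}_p$ independently. Then with probability at least $1-\delta$, \[1-\varepsilon\le\mathrm{median}_{i\in[t]}\Big\{\frac{|\mathbf{x}_i|}{\mathrm{median}(|\mathcal{D}_p|)}\Big\}\le1+\varepsilon.\]
   Context: For $p\in(0,1)$, $\mathcal{D}_p$ is the (standard) $p$-stable distribution, i.e. the distribution of $\frac{\sin(p\boldsymbol\theta)}{\cos^{1/p}(\boldsymbol\theta)}\big(\frac{\cos(\boldsymbol\theta(1-p))}{\ln(1/\mathbf{r})}\big)^{(1-p)/p}$ with $\boldsymbol\theta$ uniform on $[-\pi/2,\pi/2]$ and $\mathbf{r}$ uniform on $[0,1]$ independent. $\mathrm{median}(|\mathcal{D}_p|)=\sup\{z\in\mathbb{R}:\Pr_{\mathbf{x}\sim\mathcal{D}_p}[|\mathbf{x}|\le z]\le1/2\}$. *)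

(* Defs.v *)
From HB Require Import structures.
From mathcomp Require Import all_boot all_order all_algebra.
From mathcomp Require Import all_classical all_reals all_analysis.
From mathcomp Require Import measurable_realfun.

Set Implicit Arguments.
Unset Strict Implicit.
Unset Printing Implicit Defensive.

Import Order.TTheory GRing.Theory Num.Theory.
Import numFieldNormedType.Exports.

Local Open Scope classical_set_scope.
Local Open Scope ring_scope.

(* Where the formula is not defined (cos theta = 0, r = 0, r = 1) division by
   zero and ln return junk values; for theta uniform on [-pi/2, pi/2] and r
   uniform on [0, 1] this happens with probability zero. *)
Definition stable_formula (R : realType) (p theta r : R) : R :=
  sin (p * theta) / cos theta `^ (1 / p) *
  (cos (theta * (1 - p)) / ln (1 / r)) `^ ((1 - p) / p).

Definition stable_map (R : realType) (p : R)
    (w : measurableTypeR R * measurableTypeR R) : R :=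
  stable_formula p w.1 w.2.

Lemma measurable_fun_inv (R : realType) : measurable_fun [set: R] (@GRing.inv R).
Proof.
have <- : [set~ (0 : R)] `|` [set (0 : R)] = [set: R] by rewrite setUC setUCr.
apply/measurable_funU => //; first exact: measurableC.
split; last by apply: measurable_fun_set1.
apply: open_continuous_measurable_fun.
  exact/closed_openC/accessible_closed_set1/hausdorff_accessible/Rhausdorff.
by move=> x; rewrite inE => /= /eqP x0; exact: inv_continuous.
Qed.

Lemma measurable_stable_map (R : realType) (p : R) :
  measurable_fun [set: measurableTypeR R * measurableTypeR R] (stable_map p).
Proof.
have mcos : measurable_fun [set: R] (@cos R).
  by apply: continuous_measurable_fun; exact: continuous_cos.
have msin : measurable_fun [set: R] (@sin R).
  by apply: continuous_measurable_fun; exact: continuous_sin.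
apply: measurable_funM; first apply: measurable_funM.
- by apply: measurableT_comp => //; exact: measurable_funM.
- apply: (measurableT_comp (@measurable_fun_inv R)).
  apply: (measurableT_comp (measurable_powR _)).
  exact: measurableT_comp.
- apply: (measurableT_comp (measurable_powR _)).
  apply: measurable_funM.
    by apply: measurableT_comp => //; exact: measurable_funM.
  apply: (measurableT_comp (@measurable_fun_inv R)).
  apply: (measurableT_comp (@measurable_ln R)).
  apply: measurable_funM => //.
  exact: (measurableT_comp (@measurable_fun_inv R)).
Qed.

HB.instance Definition _ (R : realType) (p : R) :=
  isMeasurableFun.Build _ _ (measurableTypeR R * measurableTypeR R)%type R
    (stable_map p) (measurable_stable_map p).

Lemma Npihalf_lt_pihalf (R : realType) : - (pi / 2) < pi / 2 :> R.
Proof. by rewrite gtrN// divr_gt0// pi_gt0. Qed.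

Definition stable_dist (R : realType) (p : R) : probability R R :=
  distribution (uniform_prob (Npihalf_lt_pihalf R) \x uniform_prob (@ltr01 R))%E
    (stable_map p : {mfun _ >-> R}).

Definition median (R : realType) (F : R -> \bar R) : R :=
  sup [set z : R | (F z <= (1 / 2)%:E)%E].

Definition median_abs (R : realType) (mu : probability R R) : R :=
  median (fun z => mu [set x | `|x| <= z]).

(* The same supremum for an index drawn uniformly from 'I_t: the middle order
   statistic when t is odd, the upper of the two middle ones when t is even. *)
Definition sample_median (R : realType) (t : nat) (y : 'I_t -> R) : R :=
  median (fun z => (#|[pred i | y i <= z]|%:R / t%:R)%:E).

Definition mutually_independent (d : measure_display) (T : measurableType d)
    (R : realType) (P : probability T R) (I : finType)
    (X : I -> {RV P >-> R}) :=
  forall (J : {set I}) (B : I -> set R), (forall i, measurable (B i)) ->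
    P [set w | forall i, i \in J -> B i (X i w)] =
    (\prod_(i in J) P (X i @^-1` B i))%E.

(* Equality of laws is tested on Borel sets only: a probability takes
   unspecified values on non-measurable sets. *)
Definition has_law (d : measure_display) (T : measurableType d)
    (R : realType) (P : probability T R) (X : {RV P >-> R})
    (mu : probability R R) :=
  forall B : set R, measurable B -> distribution P X B = mu B.

(* Main.v *)
Require Import Defs.
From HB Require Import structures.
From mathcomp Require Import all_boot all_order all_algebra.
From mathcomp Require Import all_classical all_reals all_analysis.
From mathcomp Require Import ring lra zify.

Set Implicit Arguments.
Unset Strict Implicit.
Unset Printing Implicit Defensive.

Import Order.TTheory GRing.Theory Num.Theory.
Import numFieldNormedType.Exports.

Local Open Scope classical_set_scope.
Local Open Scope ring_scope.

(** Let m be the median of |D_p|. On theta in (0, pi/2), r in (0, 1), the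
    function p * ln |X| is nondecreasing in theta and r, and on compact
    rectangles it is Lipschitz with a constant independent of p. The box
    pi/16 <= |theta| <= 7 pi/16, 1/10 <= r <= 9/10 has probability 3/5 > 1/2,
    so m lies between the values of |X| at its two extreme corners and is
    attained at a point of the box. Just below and just above that point there
    are rectangles with sides of order p * eps on which |X| stays between
    (1 - eps) m and m, resp. between m and (1 + eps) m. Hence
    P(|X| < (1 - eps) m) <= 1/2 - eta and P(|X| <= (1 + eps) m) >= 1/2 + eta
    with eta of order (p * eps)^2.

    Writing G(x) for the probability that a Binomial(t, x) variable exceeds
    t/2, the sample median is good with probability at least
    G(1/2 + eta) - G(1/2 - eta). A Chernoff bound makes this at least
    1 - 2 exp(-2 tau) with tau = t * eta^2, which is useless for small tau;
    there, a second moment argument gives 4 tau / (1 + 4 tau). Together they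
    give 1 - exp(-tau) for all t. *)

(** * Majority probabilities of binomial laws *)

Definition binom_weight (R : realType) (t : nat) (x : R) (k : nat) : R :=
  'C(t, k)%:R * (x ^+ k * (1 - x) ^+ (t - k)).

Definition binom_expect (R : realType) (t : nat) (x : R) (f : nat -> R) : R :=
  \sum_(k < t.+1) binom_weight t x k * f k.

Lemma binom_weight_ge0 (R : realType) (t : nat) (x : R) k :
  0 <= x <= 1 -> 0 <= binom_weight t x k.
Proof.
move=> /andP[x0 x1]; rewrite mulr_ge0 ?ler0n// mulr_ge0 ?exprn_ge0//.
by rewrite subr_ge0.
Qed.

Lemma binom_expect0 (R : realType) (x : R) f : binom_expect 0 x f = f 0%N.
Proof.
by rewrite /binom_expect big_ord1 /binom_weight bin0 subnn !expr0 !mul1r.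
Qed.

(** Pascal's rule, that is, conditioning on one of the [t.+1] trials; it drives the inductions on
    [t]. *)
Lemma binom_expectS (R : realType) (t : nat) (x : R) f :
  binom_expect t.+1 x f =
  x * binom_expect t x (f \o S) + (1 - x) * binom_expect t x f.
Proof.
rewrite /binom_expect big_ord_recl /=.
under eq_bigr => i _ do
  rewrite /binom_weight /bump /= add1n binS natrD mulrDl mulrDl.
rewrite big_split /= addrA addrC; congr (_ + _).
  rewrite big_distrr /=; apply: eq_bigr => i _.
  by rewrite /binom_weight subSS exprS; ring.
(* The added term [k = t.+1] vanishes because ['C(t, t.+1)] is zero. *)
transitivity (\sum_(k < t.+2) 'C(t, k)%:R * (x ^+ k * (1 - x) ^+ (t.+1 - k)) * f k).
  by rewrite [RHS]big_ord_recl /= /binom_weight !bin0.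
rewrite big_ord_recr /= bin_small// !mul0r addr0 big_distrr /=.
apply: eq_bigr => i _; rewrite /binom_weight subSn ?exprS; last by rewrite -ltnS.
by ring.
Qed.

(** The first two moments of the binomial law. Arbitrary coefficients keep the class of integrands
    stable under composition with [S], so the induction closes. *)
Lemma binom_expect_quadratic (R : realType) (t : nat) (x a b c : R) :
  binom_expect t x (fun k => a + b * k%:R + c * k%:R ^+ 2) =
  a + b * (t%:R * x) + c * (t%:R * x * (1 - x) + (t%:R * x) ^+ 2).
Proof.
elim: t a b c => [|t IH] a b c; first by rewrite binom_expect0; ring.
rewrite binom_expectS IH.
rewrite (_ : _ \o S = fun k => (a + b + c) + (b + 2 * c) * k%:R + c * k%:R ^+ 2).
  by rewrite IH -[in RHS](natr1 t); ring.
by apply/funext => k /=; rewrite -natr1; ring.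
Qed.

Lemma ler_binom_expect (R : realType) (t : nat) (x : R) f g : 0 <= x <= 1 ->
  (forall k, (k <= t)%N -> f k <= g k) -> binom_expect t x f <= binom_expect t x g.
Proof.
move=> x01 fg; apply: ler_sum => k _; apply: ler_wpM2l.
  exact: binom_weight_ge0.
by apply: fg; rewrite -ltnS.
Qed.

(** Stochastic monotonicity: in [binom_expectS], a larger success probability moves weight from [f]
    to the larger function [f \o S]. *)
Lemma binom_expect_mono (R : realType) (t : nat) (x y : R) f :
  0 <= x -> x <= y -> y <= 1 -> {homo f : i j / (i <= j)%N >-> i <= j} ->
  binom_expect t x f <= binom_expect t y f.
Proof.
move=> x0 xy y1; elim: t f => [|t IH] f fmono; first by rewrite !binom_expect0.
rewrite !binom_expectS.
have fSmono : {homo f \o S : i j / (i <= j)%N >-> i <= j}.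
  by move=> i j ij; apply: fmono.
have IHf := IH _ fmono; have IHS := IH _ fSmono.
have fS : binom_expect t x f <= binom_expect t x (f \o S).
  apply: ler_binom_expect; first by rewrite x0 (le_trans xy).
  by move=> k _; apply: fmono.
nra.
Qed.

Lemma binom_expect_rev (R : realType) (t : nat) (x : R) f :
  binom_expect t (1 - x) f = binom_expect t x (fun k => f (t - k)%N).
Proof.
rewrite /binom_expect (reindex_inj rev_ord_inj) /=.
apply: eq_bigr => k _; have kt : (k <= t)%N by rewrite -ltnS.
by rewrite subSS /binom_weight bin_sub// subKn// subKr [X in _ * X * _]mulrC.
Qed.

(** Strict, to match [sample_median], which is at most [B] exactly when more than half of the sample
    is. *)
Definition majority (R : realType) (t k : nat) : R := (t < k.*2)%N%:R.

Lemma majority_mono (R : realType) (t : nat) :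
  {homo majority R t : i j / (i <= j)%N >-> i <= j}.
Proof. by move=> i j ij; rewrite /majority ler_nat; case: ltnP => //= h; rewrite lt0b; lia. Qed.

(** The binomial coefficients agree; after cancelling [(x * (1 - x)) ^+ (t - k)], it remains to
    compare the powers of [x] and [1 - x] with exponent [2k - t]. *)
Lemma ler_binom_weight_rev (R : realType) (t k : nat) (x : R) :
  1 / 2 <= x <= 1 -> (k <= t)%N -> (t <= k.*2)%N ->
  binom_weight t x (t - k) <= binom_weight t x k.
Proof.
move=> /andP[x2 x1] kt tk; rewrite /binom_weight bin_sub// subKn//.
apply: ler_wpM2l; first exact: ler0n.
rewrite [leRHS]mulrC; set j := (t - k)%N; have -> : k = (j + (k.*2 - t))%N by rewrite /j; lia.
rewrite !exprD [leRHS]mulrCA.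
apply: ler_wpM2l; first by rewrite exprn_ge0//; lra.
rewrite ler_wpM2l ?exprn_ge0//; first lra.
by apply: lerXn2r; rewrite ?nnegrE; lra.
Qed.

(* Pairing [k] with [t - k], the integrand contributes a nonnegative multiple of
   [(1 - l * |2k - t|)^2] plus a nonnegative remainder. *)
Lemma majority_gap_ge_quadratic (R : realType) (t : nat) (x l : R) :
  1 / 2 <= x <= 1 -> 0 <= l ->
  2 * l * binom_expect t x (fun k => 2 * k%:R - t%:R) -
  l ^+ 2 * binom_expect t x (fun k => (2 * k%:R - t%:R) ^+ 2) <=
  binom_expect t x (majority R t) - binom_expect t (1 - x) (majority R t).
Proof.
move=> x01 l0; rewrite binom_expect_rev /binom_expect.
set w := binom_weight t x.
pose F k := w k * (majority R t k - majority R t (t - k)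
  - 2 * l * (2 * k%:R - t%:R) + l ^+ 2 * (2 * k%:R - t%:R) ^+ 2).
suff : 0 <= \sum_(k < t.+1) F k.
  rewrite /F; under eq_bigr do
    rewrite mulrDr mulrBr mulrBr [X in _ - X + _]mulrCA [X in _ + X]mulrCA.
  by rewrite big_split /= sumrB sumrB -!mulr_sumr; lra.
(* Doubling the sum lets each term be added to its mirror image under [k -> t - k]. *)
suff : 0 <= \sum_(k < t.+1) F k + \sum_(k < t.+1) F k by lra.
rewrite {2}(reindex_inj rev_ord_inj) -big_split /=; apply: sumr_ge0 => k _.
have kt : (k <= t)%N by rewrite -ltnS.
rewrite subSS /F subKn// natrB//.
have w0 j : 0 <= w j.
  by apply: binom_weight_ge0; case/andP: x01 => ? ->; rewrite andbT; lra.
have [tk|kt2|tk] := ltngtP t k.*2.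
- have := ler_binom_weight_rev x01 kt (ltnW tk).
  rewrite /majority tk ltnNge (_ : (t - k).*2 <= t)%N; last by lia.
  rewrite -/(w _) -/(w k) /=; have := w0 (t - k)%N; set u := w (t - k)%N; set v := w k.
  set y : R := k%:R; set s : R := t%:R => u0 uv.
  have : 0 <= (v - u) * (1 - l * (2 * y - s)) ^+ 2 + u * (l * (2 * y - s)) ^+ 2 *+ 2.
    by rewrite addr_ge0 ?mulrn_wge0// mulr_ge0 ?sqr_ge0// subr_ge0.
  lra.
- have h : (t <= (t - k).*2)%N by lia.
  have := ler_binom_weight_rev x01 (leq_subr k t) h; rewrite subKn//.
  rewrite /majority ltnNge (ltnW kt2) (_ : t < (t - k).*2)%N; last by lia.
  rewrite -/(w _) -/(w k) /=; have := w0 k; set u := w (t - k)%N; set v := w k.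
  set y : R := k%:R; set s : R := t%:R => v0 vu.
  have : 0 <= (u - v) * (1 + l * (2 * y - s)) ^+ 2 + v * (l * (2 * y - s)) ^+ 2 *+ 2.
    by rewrite addr_ge0 ?mulrn_wge0// mulr_ge0 ?sqr_ge0// subr_ge0.
  lra.
- rewrite (_ : (t - k)%N = k); last by lia.
  have -> : t%:R = 2 * k%:R :> R by rewrite -natrM mul2n -tk.
  have := w0 k; have := sqr_ge0 (2 * k%:R - 2 * k%:R : R); rewrite subrr; nra.
Qed.

Lemma majority_gap_ge_small (R : realType) (t : nat) (eta : R) :
  0 <= eta <= 1 / 2 ->
  4 * (t%:R * eta ^+ 2) / (1 + 4 * (t%:R * eta ^+ 2)) <=
  binom_expect t (1 / 2 + eta) (majority R t) -
  binom_expect t (1 / 2 - eta) (majority R t).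
Proof.
move=> /andP[e0 e2]; set tau := t%:R * eta ^+ 2.
have t0 : 0 <= t%:R :> R by exact: ler0n.
have tau0 : 0 <= tau by rewrite mulr_ge0 ?sqr_ge0.
have d0 : 0 < 1 + 4 * tau by lra.
(* The maximiser of [2 * l * (2 * eta * t) - l ^+ 2 * (t * (1 + 4 * tau))], where [2 * eta * t] is
   the mean of [2k - t] and [t * (1 + 4 * tau)] bounds its second moment. *)
pose l := 2 * eta / (1 + 4 * tau).
have l0 : 0 <= l by rewrite divr_ge0 ?mulr_ge0// ltW.
have x01 : 1 / 2 <= 1 / 2 + eta <= 1 by apply/andP; split; lra.
have := majority_gap_ge_quadratic t x01 l0.
have -> : 1 - (1 / 2 + eta) = 1 / 2 - eta by field.
apply: le_trans.
rewrite (_ : (fun k => 2 * k%:R - t%:R) =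
   fun k => - t%:R + 2 * k%:R + 0 * k%:R ^+ 2); last by apply/funext => k; ring.
rewrite binom_expect_quadratic.
rewrite (_ : (fun k => (2 * k%:R - t%:R) ^+ 2) =
   fun k => t%:R ^+ 2 + (- 4 * t%:R) * k%:R + 4 * k%:R ^+ 2); last by apply/funext => k; ring.
rewrite binom_expect_quadratic.
have -> : 4 * tau / (1 + 4 * tau) = 2 * l * (2 * eta * t%:R) - l ^+ 2 * (t%:R * (1 + 4 * tau)).
  by rewrite /l /tau; field; rewrite -/tau gt_eqF.
have : 0 <= l ^+ 2 * (t%:R * eta ^+ 2) by rewrite mulr_ge0 ?sqr_ge0.
rewrite /tau; lra.
Qed.

(** Chernoff bound with the optimal tilt, which leads to a fair coin. If [u ^+ 2] and [v ^+ 2] are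
    the two probabilities, each outcome sequence with at most half successes has probability at most
    [(u * v) ^+ t], and there are at most [2 ^+ t] of them. Finally
    [(2uv)^2 = 1 - 4 eta^2 <= exp(-4 eta^2)]. *)
Lemma binom_expect_minority_le (R : realType) (t : nat) (eta : R) :
  0 <= eta <= 1 / 2 ->
  binom_expect t (1 / 2 + eta) (fun k => (k.*2 <= t)%N%:R) <=
  expR (- (2 * (t%:R * eta ^+ 2))).
Proof.
move=> /andP[e0 e2]; set u := Num.sqrt (1 / 2 + eta); set v := Num.sqrt (1 / 2 - eta).
have u2 : u ^+ 2 = 1 / 2 + eta by rewrite sqr_sqrtr//; lra.
have v2 : v ^+ 2 = 1 / 2 - eta by rewrite sqr_sqrtr//; lra.
have u0 : 0 <= u by exact: sqrtr_ge0.
have v0 : 0 <= v by exact: sqrtr_ge0.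
have vu : v <= u by rewrite ler_sqrt//; lra.
apply: (@le_trans _ _ ((2 * (u * v)) ^+ t)).
  rewrite /binom_expect exprMn -[2]/(1 + 1) exprDn mulr_suml.
  apply: ler_sum => k _; have kt : (k <= t)%N by rewrite -ltnS.
  rewrite /binom_weight !expr1n mulr1 -[1 *+ _]/(_%:R) -mulrA ler_wpM2l ?ler0n//.
  have -> : 1 - (1 / 2 + eta) = v ^+ 2 by rewrite v2; field.
  rewrite -u2 -!exprM; case: leqP => h; last first.
    by rewrite mulr0 exprn_ge0// mulr_ge0.
  rewrite mulr1 exprMn.
  have -> : u ^+ t = u ^+ (2 * k) * u ^+ (t - 2 * k) by rewrite -exprD; congr (u ^+ _); lia.
  have -> : v ^+ (2 * (t - k)) = v ^+ t * v ^+ (t - 2 * k).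
    by rewrite -exprD; congr (v ^+ _); lia.
  rewrite -[leRHS]mulrA; apply: ler_wpM2l; first exact: exprn_ge0.
  rewrite [leRHS]mulrC; apply: ler_wpM2l; first exact: exprn_ge0.
  by apply: lerXn2r; rewrite ?nnegrE.
rewrite (_ : - _ = t%:R * (- (2 * eta ^+ 2))); last by ring.
rewrite expRM_natl; apply: lerXn2r; rewrite ?nnegrE ?expR_ge0 ?mulr_ge0//.
rewrite -(@ler_pXn2r _ 2%N)// ?nnegrE ?expR_ge0 ?mulr_ge0// -expRM_natl.
apply: le_trans (expR_ge1Dx _).
by rewrite !exprMn u2 v2; lra.
Qed.

(** Reflection turns the difference into one expectation, whose integrand is at least 1 minus twice
    the indicator of [k.*2 <= t]. *)
Lemma majority_gap_ge_large (R : realType) (t : nat) (eta : R) :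
  0 <= eta <= 1 / 2 ->
  1 - 2 * expR (- (2 * (t%:R * eta ^+ 2))) <=
  binom_expect t (1 / 2 + eta) (majority R t) -
  binom_expect t (1 / 2 - eta) (majority R t).
Proof.
move=> eta01; have := binom_expect_minority_le t eta01.
have /andP[e0 e2] := eta01.
have -> : 1 / 2 - eta = 1 - (1 / 2 + eta) by field.
rewrite binom_expect_rev => h.
(* The constant 1 is written as a quadratic so that [binom_expect_quadratic] evaluates its
   expectation. *)
apply: (@le_trans _ _ (binom_expect t (1 / 2 + eta) (fun k => 1 + 0 * k%:R + 0 * k%:R ^+ 2)
   - 2 * binom_expect t (1 / 2 + eta) (fun k => (k.*2 <= t)%N%:R))).
  by rewrite binom_expect_quadratic; lra.
rewrite mulr_sumr -!sumrB; apply: ler_sum => k _.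
rewrite [2 * (_ * _)]mulrCA -!mulrBr; apply: ler_wpM2l.
  by apply: binom_weight_ge0; apply/andP; split; lra.
have := ltn_ord k; rewrite ltnS => kt.
rewrite /majority; case: (ltnP t k.*2) => h1; case: (ltnP t (t - k).*2) => h2 /=; lia || lra.
Qed.

Lemma majority_gap_ge (R : realType) (t : nat) (eta : R) :
  0 <= eta <= 1 / 2 ->
  1 - expR (- (t%:R * eta ^+ 2)) <=
  binom_expect t (1 / 2 + eta) (majority R t) -
  binom_expect t (1 / 2 - eta) (majority R t).
Proof.
move=> eta01.
have := majority_gap_ge_small t eta01; have := majority_gap_ge_large t eta01.
set tau := t%:R * eta ^+ 2 => hlarge hsmall.
have tau0 : 0 <= tau by rewrite mulr_ge0 ?sqr_ge0.
have [tau1|tau1] := leP tau 1.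
  apply: le_trans hsmall.
  have e1 : 1 - tau / 2 <= expR (- (tau / 2)) by exact: expR_ge1Dx.
  have e2 : (1 - tau / 2) ^+ 2 <= expR (- tau).
    rewrite (_ : - tau = 2%:R * (- (tau / 2))); last by field.
    by rewrite expRM_natl; apply: lerXn2r; rewrite ?nnegrE ?expR_ge0//; lra.
  rewrite ler_pdivlMr; last by lra.
  (* A hint for [nra]: [4 * tau - (1 - (1 - tau / 2) ^+ 2) * (1 + 4 * tau)] is this cubic plus
     [tau * (2 - 7 / 4 * tau)]. *)
  have : 0 <= tau * (1 - tau) ^+ 2 by rewrite mulr_ge0 ?sqr_ge0.
  have : (1 - expR (- tau)) * (1 + 4 * tau) <= (1 - (1 - tau / 2) ^+ 2) * (1 + 4 * tau).
    by apply: ler_wpM2r; lra.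
  nra.
apply: le_trans hlarge.
have := expR_gt0 (- tau); have : expR (- (2 * tau)) = expR (- tau) ^+ 2.
  by rewrite -expRM_natl; congr expR; ring.
move=> ->.
have : expR (- tau) <= 1 / 2.
  rewrite expRN div1r lef_pV2 ?posrE ?expR_gt0//.
  by apply: le_trans (expR_ge1Dx _); lra.
nra.
Qed.

(** * The logarithm of the stable variable *)

Lemma ler_cos_0pi (R : realType) (x y : R) :
  0 <= x -> x <= y -> y <= pi -> cos y <= cos x.
Proof.
rewrite le_eqVlt => x0; rewrite le_eqVlt => /predU1P[->//|xy] ypi.
have {}x0 : 0 <= x by rewrite le_eqVlt.
by apply/ltW; rewrite ltr_cos// in_itv /=; apply/andP; split; lra.
Qed.

Lemma ler_sin_pihalf (R : realType) (x y : R) :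
  - (pi / 2) <= x -> x <= y -> y <= pi / 2 -> sin x <= sin y.
Proof.
move=> x0; rewrite le_eqVlt => /predU1P[->//|xy] ypi.
by apply/ltW; rewrite ltr_sin// in_itv /=; apply/andP; split; lra.
Qed.

Lemma sin_sub_le (R : realType) (x y : R) : x <= y -> sin y - sin x <= y - x.
Proof.
move=> xy; have [||z _ ->] := @MVT_segment R sin cos x y.
- by [].
- by apply: continuous_subspaceT => z; exact: continuous_sin.
by rewrite ler_piMl ?subr_ge0// cos_le1.
Qed.

Lemma cos_sub_le (R : realType) (x y : R) : x <= y -> cos x - cos y <= y - x.
Proof.
move=> xy; have [||z _] := @MVT_segment R cos (fun x => - sin x) x y.
- by [].
- by apply: continuous_subspaceT => z; exact: continuous_cos.
move=> h; rewrite -opprB h mulNr opprK ler_piMl ?subr_ge0// sin_le1.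
Qed.

Lemma sin_ge_mul_cos (R : realType) (x : R) : 0 <= x <= pi -> x * cos x <= sin x.
Proof.
move=> /andP[x0 xpi]; have [||z] := @MVT_segment R sin cos 0 x.
- by [].
- by apply: continuous_subspaceT => z; exact: continuous_sin.
rewrite in_itv /= => /andP[z0 zx]; rewrite sin0 !subr0 => ->.
by rewrite mulrC ler_wpM2r//; apply: ler_cos_0pi.
Qed.

Lemma ln_sub_le (R : realType) (x y : R) : 0 < x -> 0 < y -> ln y - ln x <= (y - x) / x.
Proof.
move=> x0 y0; rewrite -ln_div ?posrE//.
have -> : y / x = 1 + (y - x) / x by field; rewrite gt_eqF.
apply: le_ln1Dx; rewrite ltr_pdivlMr//; lra.
Qed.

(** The logarithm of [stable_formula] for positive angles, times [p]. This factor clears the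
    exponents [1 / p] and [(1 - p) / p] and makes Lipschitz bounds uniform in [p]. *)
Definition stable_log (R : realType) (p theta r : R) : R :=
  p * ln (sin (p * theta)) - ln (cos theta)
  + (1 - p) * ln (cos (theta * (1 - p))) - (1 - p) * ln (- ln r).

Lemma stable_formulaE (R : realType) (p theta r : R) :
  0 < p < 1 -> 0 < theta < pi / 2 -> 0 < r < 1 ->
  stable_formula p theta r = expR (stable_log p theta r / p).
Proof.
move=> /andP[p0 p1] /andP[t0 tpi] /andP[r0 r1].
have s0 : 0 < sin (p * theta) by apply: sin_gt0_pihalf; apply/andP; split; nra.
have c0 : 0 < cos theta by apply: cos_gt0_pihalf; apply/andP; split; lra.
have c1 : 0 < cos (theta * (1 - p)) by apply: cos_gt0_pihalf; apply/andP; split; nra.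
have l0 : 0 < - ln r by rewrite oppr_gt0 ln_lt0// r0.
rewrite /stable_formula (div1r r) lnV ?posrE//.
have q0 : 0 < cos (theta * (1 - p)) / - ln r by rewrite divr_gt0.
rewrite /powR !gt_eqF// -{1}(lnK (x := sin _)) ?posrE// -expRN -!expRD.
rewrite ln_div ?posrE// /stable_log; congr expR.
by field; rewrite gt_eqF.
Qed.

Lemma stable_formulaN (R : realType) (p theta r : R) :
  stable_formula p (- theta) r = - stable_formula p theta r.
Proof. by rewrite /stable_formula mulrN sinN mulNr !cosN !mulNr cosN. Qed.

(* Product-to-sum formulas reduce the claim to the monotonicity of [cos]. *)
Lemma cos_scale_cross_le (R : realType) (q a b : R) :
  0 <= q <= 1 -> 0 <= a -> a <= b -> b <= pi / 2 ->
  cos (a * q) * cos b <= cos (b * q) * cos a.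
Proof.
move=> /andP[q0 q1] a0 ab bpi.
have h1 : cos (b + a * q) <= cos (a + b * q) by apply: ler_cos_0pi; nra.
have h2 : cos (b - a * q) <= cos (a - b * q).
  rewrite -[cos (a - _)]cos_norm; apply: ler_cos_0pi => //; last nra.
  by rewrite ler_norml; apply/andP; split; nra.
by rewrite !cosD in h1; rewrite !cosB in h2; lra.
Qed.

(** The sine and [r] terms are monotone by inspection. With [q = 1 - p], the rest is [ln (cos (q
    theta) / cos theta) - p * ln (cos (q theta))]: the ratio is nondecreasing by
    [cos_scale_cross_le], and [cos (q theta)] is nonincreasing. *)
Lemma stable_log_le (R : realType) (p a b r s : R) :
  0 < p < 1 -> 0 < a -> a <= b -> b < pi / 2 -> 0 < r -> r <= s -> s < 1 ->
  stable_log p a r <= stable_log p b s.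
Proof.
move=> /andP[p0 p1] a0 ab bpi r0 rs s1.
have sin0 : 0 < sin (p * a) by apply: sin_gt0_pihalf; apply/andP; split; nra.
have sinab : sin (p * a) <= sin (p * b) by apply: ler_sin_pihalf; nra.
have c0 : 0 < cos b by apply: cos_gt0_pihalf; apply/andP; split; lra.
have cab : cos b <= cos a by apply: ler_cos_0pi; lra.
have d0 : 0 < cos (b * (1 - p)) by apply: cos_gt0_pihalf; apply/andP; split; nra.
have dab : cos (b * (1 - p)) <= cos (a * (1 - p)) by apply: ler_cos_0pi; nra.
have := @cos_scale_cross_le R (1 - p) a b.
move=> /(_ _ _ ab) h; have {}h : cos (a * (1 - p)) * cos b <= cos (b * (1 - p)) * cos a.
  by apply: h; [apply/andP; split| |]; lra.
have l0 : 0 < - ln s by rewrite oppr_gt0 ln_lt0// s1 andbT; lra.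
have lrs : - ln s <= - ln r by rewrite lerN2 ler_ln ?posrE//; lra.
have e1 : ln (sin (p * a)) <= ln (sin (p * b)) by rewrite ler_ln ?posrE//; lra.
have e2 : ln (- ln s) <= ln (- ln r) by rewrite ler_ln ?posrE//; lra.
have e3 : ln (cos (b * (1 - p))) <= ln (cos (a * (1 - p))) by rewrite ler_ln ?posrE//; lra.
have : ln (cos (a * (1 - p)) * cos b) <= ln (cos (b * (1 - p)) * cos a).
  by rewrite ler_ln ?posrE ?mulr_gt0//; lra.
rewrite !lnM ?posrE//; try lra.
rewrite /stable_log => e4; nra.
Qed.

Lemma stable_log_ltr (R : realType) (p a r s : R) :
  0 < p < 1 -> 0 < r -> r < s -> s < 1 -> stable_log p a r < stable_log p a s.
Proof.
move=> /andP[p0 p1] r0 rs s1.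
have l0 : 0 < - ln s by rewrite oppr_gt0 ln_lt0// s1 andbT; lra.
have lrs : - ln s < - ln r by rewrite ltrN2 ltr_ln ?posrE//; lra.
have e2 : ln (- ln s) < ln (- ln r) by rewrite ltr_ln ?posrE//; lra.
by rewrite /stable_log ler_ltD// ltrN2 ltr_pM2l// subr_gt0.
Qed.

(** The bound is free of [p]: the increment [p * (b - a)] of the sine's argument is divided by
    [sin (p * a) >= p * a * cos b], so [p] cancels. The term in [cos (theta * (1 - p))] only
    decreases, and [1 - s <= - ln s] controls the double logarithm. *)
Lemma stable_log_sub_le (R : realType) (p a b r s : R) :
  0 < p < 1 -> 0 < a -> a <= b -> b < pi / 2 -> 0 < r -> r <= s -> s < 1 ->
  stable_log p b s - stable_log p a r <=
  (b - a) * ((a^-1 + 1) / cos b) + (s - r) / (r * (1 - s)).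
Proof.
move=> /andP[p0 p1] a0 ab bpi r0 rs s1.
have sin0 : 0 < sin (p * a) by apply: sin_gt0_pihalf; apply/andP; split; nra.
have sinab : sin (p * a) <= sin (p * b) by apply: ler_sin_pihalf; nra.
have c0 : 0 < cos b by apply: cos_gt0_pihalf; apply/andP; split; lra.
have cab : cos b <= cos a by apply: ler_cos_0pi; lra.
have d0 : 0 < cos (b * (1 - p)) by apply: cos_gt0_pihalf; apply/andP; split; nra.
have dab : cos (b * (1 - p)) <= cos (a * (1 - p)) by apply: ler_cos_0pi; nra.
have l0 : 0 < - ln s by rewrite oppr_gt0 ln_lt0// s1 andbT; lra.
have lrs : - ln s <= - ln r by rewrite lerN2 ler_ln ?posrE//; lra.
have nn : 0 <= (b - a) * (a^-1 / cos b).
  by rewrite mulr_ge0 ?subr_ge0// divr_ge0 ?invr_ge0// ltW.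
have e1 : p * (ln (sin (p * b)) - ln (sin (p * a))) <= (b - a) * (a^-1 / cos b).
  apply: (@le_trans _ _ (p * ((b - a) * (a^-1 / cos b)))); last first.
    by apply: ler_piMl => //; exact: ltW.
  rewrite ler_pM2l//; apply: (le_trans (ln_sub_le sin0 _)); first lra.
  rewrite ler_pdivrMr//.
  have h1 : sin (p * b) - sin (p * a) <= p * (b - a).
    by rewrite mulrBr; apply: sin_sub_le; rewrite ler_pM2l.
  have h2 : p * a * cos b <= sin (p * a).
    apply: (@le_trans _ _ (p * a * cos (p * a))); last first.
      by apply: sin_ge_mul_cos; apply/andP; split; nra.
    by rewrite ler_pM2l ?mulr_gt0//; apply: ler_cos_0pi; nra.
  apply: (le_trans h1).
  have -> : p * (b - a) = (b - a) * (a^-1 / cos b) * (p * a * cos b).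
    by field; rewrite !gt_eqF.
  exact: ler_wpM2l.
have e2 : ln (cos a) - ln (cos b) <= (b - a) / cos b.
  apply: (le_trans (ln_sub_le c0 _)); first lra.
  by rewrite ler_pM2r ?invr_gt0//; exact: cos_sub_le.
have e3 : ln (cos (b * (1 - p))) <= ln (cos (a * (1 - p))) by rewrite ler_ln ?posrE//; lra.
have e4 : (1 - p) * (ln (- ln r) - ln (- ln s)) <= (s - r) / (r * (1 - s)).
  have w0 : 0 <= ln (- ln r) - ln (- ln s) by rewrite subr_ge0 ler_ln ?posrE//; lra.
  apply: (@le_trans _ _ (ln (- ln r) - ln (- ln s))); first by apply: ler_piMl; lra.
  apply: (le_trans (ln_sub_le l0 _)); first lra.
  have -> : - ln r - - ln s = ln s - ln r by ring.
  have g1 : ln s - ln r <= (s - r) / r by apply: ln_sub_le; lra.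
  have g2 : 1 - s <= - ln s.
    have : ln (1 + (s - 1)) <= s - 1 by apply: le_ln1Dx; lra.
    by rewrite addrC subrK; lra.
  rewrite invfM mulrA; apply: ler_pM => //; rewrite ?invr_ge0 ?subr_ge0 ?ler_ln ?posrE//; try lra.
  by rewrite lef_pV2 ?posrE//; lra.
have -> : (b - a) * ((a^-1 + 1) / cos b) = (b - a) * (a^-1 / cos b) + (b - a) / cos b.
  by ring.
rewrite /stable_log; nra.
Qed.

(** * Mass of the stable law around its median *)

Lemma uniform_prob_itv (R : realType) (a b c d : R) (ab : a < b) :
  a <= c -> c <= d -> d <= b ->
  uniform_prob ab `[c, d] = ((d - c) / (b - a))%:E.
Proof.
move=> ac cd db; rewrite /uniform_prob.
under eq_integral => x.
  rewrite inE /= in_itv /= => /andP[cx xd].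
  rewrite /uniform_pdf (le_trans ac cx) (le_trans xd db) /=.
  over.
rewrite integral_cst//= lebesgue_measure_itv /= lte_fin.
case: ltP => [cd'|dc]; first by rewrite -EFinB -EFinM mulrC.
by rewrite mule0 (_ : d - c = 0) ?mul0r//; lra.
Qed.

Lemma stable_dist_rect_ge (R : realType) (p a b c d : R) (B : set R) :
  measurable B -> - (pi / 2) <= a -> a <= b -> b <= pi / 2 ->
  0 <= c -> c <= d -> d <= 1 ->
  (forall theta r, a <= theta <= b -> c <= r <= d -> B (stable_formula p theta r)) ->
  (((b - a) / pi * (d - c))%:E <= stable_dist p B)%E.
Proof.
move=> mB pa ab bp c0 cd d1 hB.
have -> : (((b - a) / pi * (d - c))%:E =
  (uniform_prob (Npihalf_lt_pihalf R) \x uniform_prob (@ltr01 R)) (`[a, b] `*` `[c, d]))%E.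
  rewrite product_measure1E//= !uniform_prob_itv// -EFinM subr0 divr1.
  by rewrite opprK -splitr.
rewrite /stable_dist /distribution /pushforward.
apply: le_measure; rewrite ?inE.
- exact: measurableX.
- by rewrite -[X in measurable X]setTI; exact: measurable_stable_map.
- move=> [theta r] /= []; rewrite !in_itv /= => h1 h2; exact: hB.
Qed.

(** Continuity along the diagonal of a rectangle, for the intermediate value theorem. *)
Lemma stable_log_line_continuous (R : realType) (p a b c d : R) :
  0 < p < 1 -> 0 < a -> a <= b -> b < pi / 2 -> 0 < c -> c <= d -> d < 1 ->
  {within `[0, 1], continuous
    (fun u : R => stable_log p (a + u * (b - a)) (c + u * (d - c)))}.
Proof.
move=> /andP[p0 p1] a0 ab bpi c0 cd d1.
apply: continuous_in_subspaceT => x; rewrite inE /= in_itv /= => /andP[x0 x1].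
have cth : {for x, continuous (fun u : R => a + u * (b - a))}.
  by apply: cvgD; [exact: cvg_cst|apply: cvgMl; exact: cvg_id].
have cr : {for x, continuous (fun u : R => c + u * (d - c))}.
  by apply: cvgD; [exact: cvg_cst|apply: cvgMl; exact: cvg_id].
have t1 : a <= a + x * (b - a) by nra.
have t2 : a + x * (b - a) <= b by nra.
have r1 : c <= c + x * (d - c) by nra.
have r2 : c + x * (d - c) <= d by nra.
have s0 : 0 < sin (p * (a + x * (b - a))) by apply: sin_gt0_pihalf; apply/andP; split; nra.
have k0 : 0 < cos (a + x * (b - a)) by apply: cos_gt0_pihalf; apply/andP; split; lra.
have k1 : 0 < cos ((a + x * (b - a)) * (1 - p)).
  by apply: cos_gt0_pihalf; apply/andP; split; nra.
have l0 : 0 < - ln (c + x * (d - c)) by rewrite oppr_gt0 ln_lt0//; apply/andP; split; lra.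
rewrite /stable_log; apply: cvgB; last first.
  apply: cvgMr; apply: (continuous_cvg _ (continuous_ln l0)).
  by apply: cvgN; apply: (continuous_cvg _ (continuous_ln _)) => //; lra.
apply: cvgD; last first.
  apply: cvgMr; apply: (continuous_cvg _ (continuous_ln k1)).
  by apply: (continuous_cvg _ (@continuous_cos R _)); exact: cvgMl.
apply: cvgB; last first.
  apply: (continuous_cvg _ (continuous_ln k0)).
  exact: (continuous_cvg _ (@continuous_cos R _)).
apply: cvgMr; apply: (continuous_cvg _ (continuous_ln s0)).
by apply: (continuous_cvg _ (@continuous_sin R _)); exact: cvgMr.
Qed.

Lemma measurable_normr_le (R : realType) (z : R) : measurable [set x : R | `|x| <= z].
Proof.
have -> : [set x : R | `|x| <= z] = [set` `[- z, z]].
  by apply/seteqP; split=> x /=; rewrite in_itv /= ler_norml.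
exact: measurable_itv.
Qed.

Lemma measurable_normr_lt (R : realType) (z : R) : measurable [set x : R | `|x| < z].
Proof.
have -> : [set x : R | `|x| < z] = [set` `]- z, z[].
  by apply/seteqP; split=> x /=; rewrite in_itv /= ltr_norml.
exact: measurable_itv.
Qed.

Lemma probability_addI_le (R : realType) (mu : probability R R) (A B C : set R) :
  measurable A -> measurable B -> measurable C -> A `&` B = set0 ->
  A `<=` C -> B `<=` C -> (mu A + mu B <= mu C)%E.
Proof.
move=> mA mB mC AB AC BC; rewrite -measureU//.
apply: le_measure; rewrite ?inE//; first exact: measurableU.
by move=> x [/AC|/BC].
Qed.

(** The rectangle and its reflection in [theta] yield values of opposite signs, so their masses add
    up; hence the factor 2. *)
Lemma stable_dist_box_ge (R : realType) (p a b c d : R) (B : set R) :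
  0 < p < 1 -> measurable B -> 0 < a -> a <= b -> b < pi / 2 ->
  0 < c -> c <= d -> d < 1 ->
  (forall theta r, a <= theta <= b -> c <= r <= d ->
    B (stable_formula p theta r) /\ B (- stable_formula p theta r)) ->
  ((2 * ((b - a) / pi * (d - c)))%:E <= stable_dist p B)%E.
Proof.
move=> p01 mB a0 ab bpi c0 cd d1 hB.
have pos theta r : a <= theta <= b -> c <= r <= d -> 0 < stable_formula p theta r.
  move=> /andP[t1 t2] /andP[r1 r2].
  by rewrite stable_formulaE ?expR_gt0//; apply/andP; split; lra.
have h1 : (((b - a) / pi * (d - c))%:E <= stable_dist p (B `&` [set` `]0, +oo[%R]))%E.
  apply: stable_dist_rect_ge; try lra; first exact: measurableI.
  by move=> t r ht hr; split; [case: (hB t r ht hr)|rewrite /= in_itv /= andbT pos].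
have h2 : (((b - a) / pi * (d - c))%:E <= stable_dist p (B `&` [set` `]-oo, 0[%R]))%E.
  rewrite (_ : b - a = - a - - b); last by ring.
  apply: stable_dist_rect_ge; try lra; first exact: measurableI.
  move=> t r /andP[t1 t2] hr; rewrite -[t]opprK stable_formulaN.
  have ht : a <= - t <= b by apply/andP; split; lra.
  by split; [case: (hB _ r ht hr)|rewrite /= in_itv /= oppr_lt0 pos].
rewrite mulr_natl mulr2n EFinD; apply: (le_trans (leeD h1 h2)).
apply: probability_addI_le;
  [exact: measurableI|exact: measurableI|by []| |by move=> x []|by move=> x []].
apply/seteqP; split => // x [] [_ /=]; rewrite in_itv /= andbT => x0 [_ /=].
by rewrite in_itv /= ltNge (ltW x0).
Qed.

Lemma le_probability_normr (R : realType) (mu : probability R R) (y z : R) : y <= z ->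
  (mu [set x | (`|x| <= y)%R] <= mu [set x | (`|x| <= z)%R])%E.
Proof.
move=> yz; apply: le_measure; rewrite ?inE; try exact: measurable_normr_le.
by move=> x /= /le_trans; apply.
Qed.

Lemma probability_normr_le_half (R : realType) (mu : probability R R) (z : R) :
  has_sup [set z : R | (mu [set x | (`|x| <= z)%R] <= (1 / 2)%:E)%E] ->
  z < median_abs mu -> (mu [set x | (`|x| <= z)%R] <= (1 / 2)%:E)%E.
Proof.
move=> hs zm; have [s Ss zs] := sup_gt hs.1 zm.
by apply: le_trans Ss; apply: le_probability_normr; exact: ltW.
Qed.

Lemma probability_normr_gt_half (R : realType) (mu : probability R R) (z : R) :
  has_sup [set z : R | (mu [set x | (`|x| <= z)%R] <= (1 / 2)%:E)%E] ->
  median_abs mu < z -> ((1 / 2)%:E < mu [set x | (`|x| <= z)%R])%E.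
Proof.
move=> hs; apply: contraTT; rewrite -!leNgt => Sz.
exact: sup_upper_bound.
Qed.

Lemma box_mass (R : realType) (x : R) : 0 < x ->
  2 * ((7 * x / 16 - x / 16) / x * (9 / 10 - 1 / 10)) = 3 / 5.
Proof. by move=> x0; field; rewrite gt_eqF. Qed.

Lemma stable_dist_lt_bottom (R : realType) (p z : R) : 0 < p < 1 ->
  z < expR (stable_log p (pi / 16) (1 / 10) / p) ->
  (stable_dist p [set x | (`|x| <= z)%R] <= (1 / 2)%:E)%E.
Proof.
move=> p01 hz; have /andP[p0 p1] := p01; have pi0 := pi_gt0 R.
have mz := measurable_normr_le z.
have : ((2 * ((7 * pi / 16 - pi / 16) / pi * (9 / 10 - 1 / 10)))%:E <=
    stable_dist p (~` [set x | (`|x| <= z)%R]))%E.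
  apply: stable_dist_box_ge => //; try lra; first exact: measurableC.
  move=> t r /andP[t1 t2] /andP[r1 r2].
  have : z < stable_formula p t r.
    rewrite stable_formulaE//; try by apply/andP; split; lra.
    apply: (lt_le_trans hz); rewrite ler_expR ler_pM2r ?invr_gt0//.
    by apply: stable_log_le => //; lra.
  move=> zx; split=> /=; apply/negP; rewrite -ltNge ?normrN;
    exact: lt_le_trans zx (ler_norm _).
rewrite probability_setC//.
rewrite box_mass//.
have : stable_dist p [set x | (`|x| <= z)%R] \is a fin_num by exact: fin_num_measure.
by move=> /fineK <-; rewrite -EFinB !lee_fin; lra.
Qed.

Lemma stable_dist_ge_top (R : realType) (p z : R) : 0 < p < 1 ->
  expR (stable_log p (7 * pi / 16) (9 / 10) / p) <= z ->
  ((1 / 2)%:E < stable_dist p [set x | (`|x| <= z)%R])%E.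
Proof.
move=> p01 hz; have /andP[p0 p1] := p01; have pi0 := pi_gt0 R.
apply: (@lt_le_trans _ _ (2 * ((7 * pi / 16 - pi / 16) / pi * (9 / 10 - 1 / 10)))%:E).
  rewrite lte_fin.
  by rewrite box_mass//; lra.
apply: stable_dist_box_ge => //; try lra; first exact: measurable_normr_le.
move=> t r /andP[t1 t2] /andP[r1 r2] /=; rewrite normrN.
suff : `|stable_formula p t r| <= z by [].
rewrite stable_formulaE; try by apply/andP; split; lra.
rewrite gtr0_norm ?expR_gt0//; apply: le_trans hz.
rewrite ler_expR ler_pM2r ?invr_gt0//; apply: stable_log_le => //; lra.
Qed.

Lemma stable_dist_has_sup (R : realType) (p : R) : 0 < p < 1 ->
  has_sup [set z : R | (stable_dist p [set x | (`|x| <= z)%R] <= (1 / 2)%:E)%E].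
Proof.
move=> p01; split.
  exists (expR (stable_log p (pi / 16) (1 / 10) / p) - 1).
  by apply: stable_dist_lt_bottom => //; lra.
exists (expR (stable_log p (7 * pi / 16) (9 / 10) / p)) => z /= Sz.
by rewrite leNgt; apply/negP => /ltW /(stable_dist_ge_top p01); rewrite ltNge Sz.
Qed.

(** The median lies between the values at the extreme corners of the box, so the intermediate value
    theorem along the diagonal finds a point where it is attained. *)
Lemma median_abs_stableE (R : realType) (p : R) : 0 < p < 1 ->
  exists theta r, [/\ pi / 16 <= theta <= 7 * pi / 16, 1 / 10 <= r <= 9 / 10 &
    median_abs (stable_dist p) = expR (stable_log p theta r / p)].
Proof.
move=> p01; have /andP[p0 p1] := p01; have pi0 := pi_gt0 R.
have hs := stable_dist_has_sup p01; set m := median_abs _.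
have mb : expR (stable_log p (pi / 16) (1 / 10) / p) <= m.
  (* Otherwise the midpoint of [m] and the corner value would belong to the set whose supremum is
     [m]. *)
  rewrite leNgt; apply/negP => /midf_lt[h1 h2].
  have := sup_upper_bound hs (stable_dist_lt_bottom p01 h2).
  by rewrite -/(median _) -/(median_abs _) -/m leNgt h1.
have mt : m <= expR (stable_log p (7 * pi / 16) (9 / 10) / p).
  apply: ge_sup; first exact: hs.1.
  move=> z /= Sz; rewrite leNgt; apply/negP => /ltW /(stable_dist_ge_top p01).
  by rewrite ltNge Sz.
have m0 : 0 < m by apply: lt_le_trans mb; exact: expR_gt0.
have lnb : stable_log p (pi / 16) (1 / 10) <= p * ln m.
  by rewrite -(ler_pdivrMl _ _ p0) mulrC -ler_expR lnK ?posrE.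
have lnt : p * ln m <= stable_log p (7 * pi / 16) (9 / 10).
  by rewrite -(ler_pdivlMl _ _ p0) [leRHS]mulrC -ler_expR lnK ?posrE.
have [||u] := @IVT R (fun u : R => stable_log p (pi / 16 + u * (7 * pi / 16 - pi / 16))
    (1 / 10 + u * (9 / 10 - 1 / 10))) 0 1 (p * ln m) ler01.
- by apply: stable_log_line_continuous => //; lra.
- move: lnb; rewrite div1r !mul0r !mul1r !addr0 !subrKC => lnb.
  by rewrite ge_min lnb /= le_max lnt orbT.
rewrite in_itv /= => /andP[u0 u1] hu.
exists (pi / 16 + u * (7 * pi / 16 - pi / 16)), (1 / 10 + u * (9 / 10 - 1 / 10)).
split; [by apply/andP; split; nra..|].
by rewrite hu mulrC mulrA mulVf ?gt_eqF// mul1r lnK ?posrE.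
Qed.

(** The bound of [stable_log_sub_le] on an enlarged box, pi/32 <= theta <= 15 pi/32 and 1/20 <= r <=
    19/20, which contains all rectangles of side at most 1/40 around points of the original box. *)
Definition stable_lipschitz (R : realType) : R :=
  ((pi / 32)^-1 + 1) / cos (15 * pi / 32) + 20 * 20.

(** Ensures that the side length factor, a quarter of the inverse of this constant, is at most
    1/40. *)
Lemma stable_lipschitz_ge10 (R : realType) : 10 <= stable_lipschitz R.
Proof.
have pi0 := pi_gt0 R.
have k0 : 0 < cos (15 * pi / 32 : R) by apply: cos_gt0_pihalf; apply/andP; split; lra.
have : 0 <= ((pi / 32 : R)^-1 + 1) / cos (15 * pi / 32).
  by rewrite divr_ge0// ltW// addr_gt0// invr_gt0 divr_gt0.
rewrite /stable_lipschitz; move: (_ / _) => y; lra.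
Qed.

Lemma stable_log_lipschitz (R : realType) (p a b r s x : R) :
  0 < p < 1 -> pi / 32 <= a -> a <= b -> b <= 15 * pi / 32 ->
  1 / 20 <= r -> r <= s -> s <= 19 / 20 -> b - a <= x -> s - r <= x ->
  stable_log p b s - stable_log p a r <= x * stable_lipschitz R.
Proof.
move=> p01 a0 ab bpi r0 rs s1 bax srx; have pi0 := pi_gt0 R.
have k0 : 0 < cos (15 * pi / 32 : R) by apply: cos_gt0_pihalf; apply/andP; split; lra.
have cb : cos (15 * pi / 32) <= cos b by apply: ler_cos_0pi; lra.
apply: (le_trans (stable_log_sub_le _ _ _ _ _ _ _)) => //; try lra.
rewrite /stable_lipschitz [leRHS]mulrDr; apply: lerD.
  apply: ler_pM => //; first by rewrite subr_ge0.
    by rewrite divr_ge0 ?addr_ge0 ?invr_ge0//; lra.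
  apply: ler_pM.
  - by rewrite addr_ge0// invr_ge0; lra.
  - by rewrite invr_ge0; lra.
  - by rewrite lerD2r lef_pV2 ?posrE; lra.
  - by rewrite lef_pV2 ?posrE; lra.
have r20 : r^-1 <= 20 by rewrite invf_ple ?posrE; lra.
have s20 : (1 - s)^-1 <= 20 by rewrite invf_ple ?posrE; lra.
have r0' : 0 <= r^-1 by rewrite invr_ge0; lra.
have s0' : 0 <= (1 - s)^-1 by rewrite invr_ge0; lra.
rewrite invfM; apply: ler_pM; rewrite ?subr_ge0 ?mulr_ge0//.
exact: ler_pM.
Qed.

Lemma stable_dist_below_median (R : realType) (p eps x : R) :
  0 < p < 1 -> 0 < eps < 1 -> 0 < x <= 1 / 40 ->
  x * stable_lipschitz R = p * (eps / 4) ->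
  (stable_dist p [set y | (`|y| < (1 - eps) * median_abs (stable_dist p))%R] <=
    (1 / 2 - x / pi * (x / 2))%:E)%E.
Proof.
move=> p01 /andP[e0 e1] /andP[x0 x1] xL; have /andP[p0 p1] := p01; have pi2 := @pi_ge2 R.
have hs := stable_dist_has_sup p01.
have [th [r [/andP[th1 th2] /andP[r1 r2] mE]]] := median_abs_stableE p01.
move: (median_abs _) mE (@probability_normr_le_half R (stable_dist p)^~ hs) => m mE hm.
have m0 : 0 < m by rewrite mE expR_gt0.
(* Staying [x / 2] below [r] keeps the rectangle's values at or below some [v < m], where the
   distribution function of |X| is at most 1/2. *)
have vm : expR (stable_log p th (r - x / 2) / p) < m.
  rewrite mE ltr_expR ltr_pM2r ?invr_gt0//.
  by apply: stable_log_ltr => //; lra.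
have rect t s : th - x <= t <= th -> r - x <= s <= r - x / 2 ->
    (1 - eps) * m <= stable_formula p t s <= expR (stable_log p th (r - x / 2) / p).
  move=> /andP[t1 t2] /andP[s1 s2].
  rewrite stable_formulaE//; [|by apply/andP; split; lra..].
  apply/andP; split; last first.
    rewrite ler_expR ler_pM2r ?invr_gt0//.
    by apply: stable_log_le => //; lra.
  have h : stable_log p th r - stable_log p t s <= p * (eps / 4).
    by rewrite -xL; apply: stable_log_lipschitz => //; lra.
  have h2 : stable_log p th r / p - eps / 4 <= stable_log p t s / p.
    by rewrite ler_pdivlMr// mulrBl divfK ?gt_eqF//; lra.
  rewrite -ler_expR expRD -mE in h2; apply: le_trans h2.
  rewrite mulrC ler_pM2l//; apply: le_trans (expR_ge1Dx _); lra.
move: (expR _) vm rect => v vm rect.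
have vge : (1 - eps) * m <= v.
  have /andP[] : (1 - eps) * m <= stable_formula p th (r - x / 2) <= v.
    by apply: rect; apply/andP; split; lra.
  exact: le_trans.
set A := [set y : R | `|y| < (1 - eps) * m].
(* [B] receives the values on the rectangle and is disjoint from [A], so its mass is subtracted from
   1/2. *)
pose B := [set y : R | `|y| <= v] `\` A.
have mA : measurable A := measurable_normr_lt _.
have mB : measurable B by apply: measurableD => //; exact: measurable_normr_le.
have hB : ((x / pi * (x / 2))%:E <= stable_dist p B)%E.
  rewrite [X in X / pi](_ : x = th - (th - x)); last by ring.
  rewrite [x / 2](_ : _ = (r - x / 2) - (r - x)); last by field.
  apply: stable_dist_rect_ge; [exact: mB|lra..|].
  move=> t s ht hs'; have /andP[f1 f2] := rect t s ht hs'.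
  have f0 : 0 <= stable_formula p t s by apply: le_trans f1; rewrite mulr_ge0//; lra.
  by split; rewrite /A /= ger0_norm//; apply/negP; rewrite -leNgt.
have hAB : (stable_dist p A + stable_dist p B <= (1 / 2)%:E)%E.
  apply: le_trans (hm _ vm).
  apply: probability_addI_le => //; first exact: measurable_normr_le.
  - by apply/seteqP; split=> // y [] ? [].
  - by move=> y /= /ltW /le_trans; apply.
  - by move=> y [].
rewrite EFinB leeBrDr//; apply: le_trans hAB.
exact: leeD2l.
Qed.

Lemma stable_dist_above_median (R : realType) (p eps x : R) :
  0 < p < 1 -> 0 < eps < 1 -> 0 < x <= 1 / 40 ->
  x * stable_lipschitz R = p * (eps / 4) ->
  ((1 / 2 + x / pi * (x / 2))%:E <=
    stable_dist p [set y | (`|y| <= (1 + eps) * median_abs (stable_dist p))%R])%E.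
Proof.
move=> p01 /andP[e0 e1] /andP[x0 x1] xL; have /andP[p0 p1] := p01; have pi2 := @pi_ge2 R.
have hs := stable_dist_has_sup p01.
have [th [r [/andP[th1 th2] /andP[r1 r2] mE]]] := median_abs_stableE p01.
move: (median_abs _) mE (@probability_normr_gt_half R (stable_dist p)^~ hs) => m mE hm.
have m0 : 0 < m by rewrite mE expR_gt0.
have mw : m < expR (stable_log p th (r + x / 2) / p).
  rewrite mE ltr_expR ltr_pM2r ?invr_gt0//.
  by apply: stable_log_ltr => //; lra.
have rect t s : th <= t <= th + x -> r + x / 2 <= s <= r + x ->
    expR (stable_log p th (r + x / 2) / p) <= stable_formula p t s <= (1 + eps) * m.
  move=> /andP[t1 t2] /andP[s1 s2].
  rewrite stable_formulaE//; [|by apply/andP; split; lra..].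
  apply/andP; split.
    rewrite ler_expR ler_pM2r ?invr_gt0//.
    by apply: stable_log_le => //; lra.
  have h : stable_log p t s - stable_log p th r <= p * (eps / 4).
    by rewrite -xL; apply: stable_log_lipschitz => //; lra.
  have h2 : stable_log p t s / p <= stable_log p th r / p + eps / 4.
    by rewrite ler_pdivrMr// mulrDl divfK ?gt_eqF//; lra.
  rewrite -ler_expR expRD -mE in h2; apply: (le_trans h2).
  rewrite mulrC ler_pM2r//.
  (* An upper bound on the exponential by reciprocals: [exp(eps/4) <= 1/(1 - eps/4) <= 1 + eps]. *)
  have := expR_ge1Dx (- (eps / 4)); rewrite expRN => h3.
  rewrite -[1 + eps]invrK -[expR _]invrK lef_pV2 ?posrE ?invr_gt0 ?expR_gt0//; last lra.
  by apply: le_trans h3; rewrite -div1r ler_pdivrMr; nra.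
move: (expR _) mw rect => w mw rect.
(* The distribution function exceeds 1/2 strictly above [m], and the rectangle's values are at least
   [w]; any [v] strictly between separates the two masses. *)
have [v1 v2] := midf_lt mw; move: ((m + w) / 2) v1 v2 => v v1 v2.
have vle : v <= (1 + eps) * m.
  apply: (le_trans (ltW v2)).
  have /andP[] : w <= stable_formula p th (r + x / 2) <= (1 + eps) * m.
    by apply: rect; apply/andP; split; lra.
  exact: le_trans.
pose A := [set y : R | `|y| <= v].
pose B := [set y : R | `|y| <= (1 + eps) * m] `\` A.
have mA : measurable A := measurable_normr_le _.
have mB : measurable B by apply: measurableD => //; exact: measurable_normr_le.
have hB : ((x / pi * (x / 2))%:E <= stable_dist p B)%E.
  rewrite [X in X / pi](_ : x = (th + x) - th); last by ring.
  rewrite [x / 2](_ : _ = (r + x) - (r + x / 2)); last by field.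
  apply: stable_dist_rect_ge; [exact: mB|lra..|].
  move=> t s ht hs'; have /andP[f1 f2] := rect t s ht hs'.
  have f0 : 0 <= stable_formula p t s by lra.
  split; rewrite /A /= ger0_norm//; apply/negP; rewrite -ltNge.
  exact: lt_le_trans v2 f1.
rewrite EFinD; apply: (le_trans (leeD (ltW (hm _ v1)) hB)).
apply: probability_addI_le => //; first exact: measurable_normr_le.
- by apply/seteqP; split=> // y [] ? [].
- by move=> y /= /le_trans; apply.
- by move=> y [].
Qed.

Lemma stable_dist_near_median (R : realType) : exists2 c : R, 0 < c <= 1 / 2 &
  forall p eps : R, 0 < p < 1 -> 0 < eps < 1 ->
  let m := median_abs (stable_dist p) in
  [/\ 0 < m,
   (stable_dist p [set x | (`|x| < (1 - eps) * m)%R] <=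
     (1 / 2 - c * (p * eps) ^+ 2)%:E)%E &
   ((1 / 2 + c * (p * eps) ^+ 2)%:E <=
     stable_dist p [set x | (`|x| <= (1 + eps) * m)%R])%E].
Proof.
have ipi0 : 0 < (pi : R)^-1 by rewrite invr_gt0 pi_gt0.
have ipi1 : (pi : R)^-1 <= 1 / 2 by rewrite div1r lef_pV2 ?posrE ?pi_gt0// pi_ge2.
have L10 := stable_lipschitz_ge10 R.
have [k [k0 k1 kL]] : exists k : R, [/\ 0 < k, k <= 1 / 40 & k * stable_lipschitz R = 1 / 4].
  (* With this [k], rectangles of side [x = k * (p * eps)] change [stable_log] by at most
     [p * (eps / 4)]. *)
  exists (4 * stable_lipschitz R)^-1; split.
  - by rewrite invr_gt0; lra.
  - by rewrite div1r lef_pV2 ?posrE; lra.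
  - by rewrite invfM -mulrA mulVf ?mulr1 ?div1r// gt_eqF//; lra.
(* Chosen so that [c * (p * eps) ^+ 2] is the mass [x / pi * (x / 2)] of a rectangle. *)
exists (k ^+ 2 / 2 * pi^-1).
  apply/andP; split; first by rewrite !mulr_gt0.
  by move: (pi^-1) ipi0 ipi1 => y y0 y1; nra.
move=> p eps p01 e01 m; have /andP[p0 p1] := p01; have /andP[e0 e1] := e01.
have pe0 : 0 < p * eps by rewrite mulr_gt0.
have pe1 : p * eps <= 1 by rewrite mulr_ile1// ltW.
have x01 : 0 < k * (p * eps) <= 1 / 40.
  by rewrite mulr_gt0//=; apply: le_trans k1; rewrite ler_piMr// ltW.
have xL : k * (p * eps) * stable_lipschitz R = p * (eps / 4).
  by rewrite mulrAC kL; field.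
have -> : k ^+ 2 / 2 * pi^-1 * (p * eps) ^+ 2 = k * (p * eps) / pi * (k * (p * eps) / 2).
  by move: (pi^-1) => y; field.
split.
- by have [th [r [_ _ mE]]] := median_abs_stableE p01; rewrite /m mE expR_gt0.
- exact: stable_dist_below_median.
- exact: stable_dist_above_median.
Qed.

(** * Sample medians *)

(** Finitely many values leave a gap just below [A], so a strict comparison with [A] becomes a weak
    one with [z]. The default [A - 1] covers the case of no value below [A]. *)
Lemma exists_lt_upper (R : realType) (I : finType) (y : I -> R) (A : R) :
  exists2 z, z < A & forall i, y i < A -> y i <= z.
Proof.
exists (\big[Num.max/A - 1]_(i | y i < A) y i).
  by apply/bigmax_ltP; split=> //; lra.
by move=> i yi; apply: le_bigmax_cond.
Qed.

Lemma exists_gt_gap (R : realType) (I : finType) (y : I -> R) (B : R) :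
  exists2 z, B < z & forall i, y i <= z -> y i <= B.
Proof.
set w := \big[Num.min/B + 1]_(i | B < y i) y i.
have Bw : B < w by apply/bigmin_gtP; split=> //; lra.
exists ((B + w) / 2); first lra.
move=> i yz; rewrite leNgt; apply/negP => Byi.
have : w <= y i := @bigmin_le_cond _ _ _ (B + 1) i (fun i => B < y i) y Byi.
by lra.
Qed.

Lemma sample_median_setE (R : realType) (t : nat) (y : 'I_t -> R) : (0 < t)%N ->
  [set z : R | ((#|[pred i | (y i <= z)%R]|%:R / t%:R : R)%:E <= (1 / 2)%:E)%E] =
  [set z : R | (#|[pred i | (y i <= z)%R]|.*2 <= t)%N].
Proof.
move=> t0; apply/funext => z /=; apply/propext; rewrite lee_fin.
rewrite ler_pdivrMr ?ltr0n// mulrAC ler_pdivlMr// mul1r -natrM muln2.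
by rewrite ler_nat.
Qed.

Lemma sample_median_has_sup (R : realType) (t : nat) (y : 'I_t -> R) : (0 < t)%N ->
  has_sup [set z : R | (#|[pred i | (y i <= z)%R]|.*2 <= t)%N].
Proof.
move=> t0; pose M := \sum_i `|y i|.
have yM i : `|y i| <= M.
  by rewrite /M (bigD1 i)//= lerDl; apply: sumr_ge0 => j _; exact: normr_ge0.
split.
  exists (- M - 1) => /=; rewrite eq_card0// => i; rewrite !inE.
  by apply/negbTE; rewrite -ltNge; have := yM i; rewrite ler_norml => /andP[]; lra.
exists M => z /=; apply: contraTT; rewrite -!ltNge => Mz.
rewrite (eq_card (B := 'I_t)); first by rewrite card_ord -ltnNge; lia.
move=> i; rewrite !inE; have := yM i; rewrite ler_norml => /andP[_ yi].
by apply: le_trans yi _; exact: ltW.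
Qed.

Lemma le_sample_median (R : realType) (t : nat) (y : 'I_t -> R) (A : R) : (0 < t)%N ->
  (A <= sample_median y) = ~~ (t < #|[pred i | (y i < A)%R]|.*2)%N.
Proof.
move=> t0; rewrite /sample_median /median sample_median_setE//.
have hs := sample_median_has_sup y t0; rewrite -leqNgt; apply/idP/idP.
  apply: contraTT; rewrite -ltnNge -ltNge => tA.
  (* More than half of the sample is already counted at [z], so the supremum is at most [z < A]. *)
  have [z zA hz] := exists_lt_upper y A.
  apply: le_lt_trans zA; apply: ge_sup; first exact: hs.1.
  move=> u /=; apply: contraTT; rewrite -ltNge -ltnNge => zu.
  apply: (leq_trans tA); rewrite leq_double; apply: subset_leq_card.
  by apply/fintype.subsetP => i; rewrite !inE => /hz yi; apply: le_trans yi _; exact: ltW.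
move=> h; rewrite leNgt; apply/negP => /midf_lt[h1 h2].
suff /(sup_upper_bound hs) : [set z : R | (#|[pred i | (y i <= z)%R]|.*2 <= t)%N]
  ((sup [set z : R | (#|[pred i | (y i <= z)%R]|.*2 <= t)%N] + A) / 2) by rewrite leNgt h1.
apply: leq_trans h; rewrite leq_double; apply: subset_leq_card.
by apply/fintype.subsetP => i; rewrite !inE => yi; exact: le_lt_trans yi h2.
Qed.

Lemma sample_median_le (R : realType) (t : nat) (y : 'I_t -> R) (B : R) : (0 < t)%N ->
  (sample_median y <= B) = (t < #|[pred i | (y i <= B)%R]|.*2)%N.
Proof.
move=> t0; rewrite /sample_median /median sample_median_setE//.
have hs := sample_median_has_sup y t0; apply/idP/idP.
  apply: contraTT; rewrite -leqNgt -ltNge => tB.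
  have [z Bz hz] := exists_gt_gap y B.
  apply: (lt_le_trans Bz); apply: (sup_upper_bound hs) => /=.
  apply: leq_trans tB; rewrite leq_double; apply: subset_leq_card.
  by apply/fintype.subsetP => i; rewrite !inE => /hz.
move=> h; apply: ge_sup; first exact: hs.1.
move=> u /=; apply: contraTT; rewrite -ltNge -ltnNge => Bu.
apply: (leq_trans h); rewrite leq_double; apply: subset_leq_card.
by apply/fintype.subsetP => i; rewrite !inE => yi; apply: le_trans yi _; exact: ltW.
Qed.

Lemma sum_set_card (R : realType) (t : nat) (a : R) (Q : pred nat) :
  \sum_(A : {set 'I_t} | Q #|A|) a ^+ #|A| * (1 - a) ^+ (t - #|A|) =
  binom_expect t a (fun k => (Q k)%:R).
Proof.
rewrite /binom_expect big_mkcond /=.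
have cardlt (A : {set 'I_t}) : (#|A| < t.+1)%N by rewrite ltnS -[t in (_ <= t)%N]card_ord max_card.
rewrite (partition_big (fun A : {set 'I_t} => Ordinal (cardlt A)) xpredT)//=.
apply: eq_bigr => k _.
rewrite (eq_bigr (fun=> a ^+ k * (1 - a) ^+ (t - k) * (Q k)%:R)); last first.
  by move=> A /eqP <- /=; case: (Q _); rewrite ?mulr1 ?mulr0.
rewrite sumr_const -[LHS]mulr_natl /binom_weight -[RHS]mulrA; congr (_%:R * _).
rewrite -[t in 'C(t, _)]card_ord -card_draws; apply: eq_card => A.
by rewrite !inE.
Qed.

(** The event splits according to the exact set [A] of indices satisfying [b]. Independence over all
    indices, with the event or its complement in each coordinate, gives each piece its product
    probability. *)
Lemma probability_count (d : measure_display) (T : measurableType d) (R : realType)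
    (P : probability T R) (t : nat) (X : 'I_t -> {RV P >-> R}) (b : pred R) (a : R)
    (Q : pred nat) :
  mutually_independent X -> measurable [set x | b x] ->
  (forall i, P (X i @^-1` [set x | b x]) = a%:E) ->
  measurable [set w | Q #|[pred i | b (X i w)]|] /\
  P [set w | Q #|[pred i | b (X i w)]|] = (binom_expect t a (fun k => (Q k)%:R))%:E.
Proof.
move=> indX mb Pa; pose E (A : {set 'I_t}) := [set w | [set i | b (X i w)]%SET = A].
pose C (A : {set 'I_t}) i := if i \in A then [set x : R | b x] else ~` [set x : R | b x].
have mC A i : measurable (C A i) by rewrite /C; case: ifP => // _; exact: measurableC.
have EE A : E A = [set w | forall i, i \in [set: 'I_t]%SET -> C A i (X i w)].
  apply/seteqP; split=> w /=.
    by rewrite /E /= => <- i _; rewrite /C inE /=; case: ifP => //= /negbT/negP.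
  move=> h; apply/setP => i; rewrite inE; have := h i (finset.in_setT _).
  by rewrite /C; case: ifP => _ //= /negP/negbTE.
have mX i B : measurable B -> measurable (X i @^-1` B).
  by move=> mB; rewrite -[X in measurable X]setTI; exact: measurable_funP.
have mE A : measurable (E A).
  rewrite EE; have -> : [set w | forall i, i \in [set: 'I_t]%SET -> C A i (X i w)] =
      \bigcap_(i in [set: 'I_t]) (X i @^-1` C A i).
    by apply/seteqP; split=> w /= h i _; [exact/h/finset.in_setT|exact: h i I].
  apply: fin_bigcap_measurable; first exact: finite_finset.
  by move=> i _; exact: mX.
have PE A : P (E A) = (a ^+ #|A| * (1 - a) ^+ (t - #|A|))%:E.
  rewrite EE indX// (eq_bigr (fun i => (if i \in A then a else 1 - a)%:E)); last first.
    move=> i _; rewrite /C; case: ifP => _; first exact: Pa.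
    by rewrite preimage_setC probability_setC ?Pa//; exact: (mX i _ mb).
  rewrite prodEFin; congr EFin.
  under eq_bigl do rewrite finset.in_setT.
  rewrite (bigID (mem A)) /=; congr (_ * _).
    by under eq_bigr => i -> do []; rewrite prodr_const.
  under eq_bigr => i /negbTE -> do [].
  rewrite prodr_const; congr (_ ^+ _).
  transitivity (#|'I_t| - #|A|)%N; last by rewrite card_ord.
  by rewrite -(cardC (mem A)) addKn.
pose s := [seq A : {set 'I_t} <- index_enum _ | Q #|A|].
have -> : [set w | Q #|[pred i | b (X i w)]|] = \bigcup_(A in [set` s]) E A.
  apply/seteqP; split=> w /=.
    move=> h; exists [set i | b (X i w)]%SET => //=.
    by rewrite mem_filter mem_index_enum andbT cardsE.
  by move=> [A /=]; rewrite mem_filter => /andP[QA _] EA; move: QA; rewrite -EA cardsE.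
split; first by apply: fin_bigcup_measurable => //; exact: finite_seq.
rewrite measure_fin_bigcup//; last first.
  by move=> A1 A2 _ _ [w [<- <-]].
rewrite -fsbig_seq ?filter_uniq ?index_enum_uniq//= big_filter /=.
by rewrite (eq_bigr _ (fun A _ => PE A)) sumEFin sum_set_card.
Qed.

(** The median is good exactly when a majority is at most [(1 + eps) * m] but no majority is below
    [(1 - eps) * m]. These majority events are nested, so the probability is a difference of two
    binomial majorities, and monotonicity moves their parameters to [1 / 2 + eta] and
    [1 / 2 - eta]. *)
Lemma sample_median_concentration (R : realType) (mu : probability R R) (m eps eta : R)
    (t : nat) (d : measure_display) (T : measurableType d) (P : probability T R)
    (X : 'I_t -> {RV P >-> R}) :
  (0 < t)%N -> 0 < m -> 0 <= eps -> 0 <= eta <= 1 / 2 ->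
  (mu [set x | (`|x| < (1 - eps) * m)%R] <= (1 / 2 - eta)%:E)%E ->
  ((1 / 2 + eta)%:E <= mu [set x | (`|x| <= (1 + eps) * m)%R])%E ->
  (forall i, has_law (X i) mu) -> mutually_independent X ->
  ((1 - expR (- (t%:R * eta ^+ 2)))%:E <=
    P [set w | (1 - eps <= sample_median (fun i => `|X i w| / m) <= 1 + eps)%R])%E.
Proof.
move=> t0 m0 e0 eta01 hA hB lawX indX.
pose bA (x : R) := `|x| < (1 - eps) * m; pose bB (x : R) := `|x| <= (1 + eps) * m.
have mA : measurable [set x : R | bA x] := measurable_normr_lt _.
have mB : measurable [set x : R | bB x] := measurable_normr_le _.
have finA : mu [set x | bA x] \is a fin_num by exact: fin_num_measure.
have finB : mu [set x | bB x] \is a fin_num by exact: fin_num_measure.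
set alpha := fine (mu [set x | bA x]); set beta := fine (mu [set x | bB x]).
have PA i : P (X i @^-1` [set x | bA x]) = alpha%:E.
  by rewrite /alpha fineK//; exact: lawX.
have PB i : P (X i @^-1` [set x | bB x]) = beta%:E.
  by rewrite /beta fineK//; exact: lawX.
have {}hA : alpha <= 1 / 2 - eta by rewrite -lee_fin fineK.
have {}hB : 1 / 2 + eta <= beta by rewrite -lee_fin fineK.
have a0 : 0 <= alpha by rewrite fine_ge0.
have b1 : beta <= 1 by rewrite -lee_fin fineK// probability_le1.
pose Q k := (t < k.*2)%N.
have [mEA PEA] := probability_count Q indX mA PA.
have [mEB PEB] := probability_count Q indX mB PB.
set EA := [set w | Q _] in mEA PEA; set EB := [set w | Q _] in mEB PEB.
have -> : [set w | (1 - eps <= sample_median (fun i => `|X i w| / m) <= 1 + eps)%R] =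
    EB `\` EA.
  have cA w : #|[pred i | `|X i w| / m < 1 - eps]| = #|[pred i | bA (X i w)]|.
    by apply: eq_card => i; rewrite !inE ltr_pdivrMr.
  have cB w : #|[pred i | `|X i w| / m <= 1 + eps]| = #|[pred i | bB (X i w)]|.
    by apply: eq_card => i; rewrite !inE ler_pdivrMr.
  apply/seteqP; split=> w /=; rewrite le_sample_median// sample_median_le// cA cB.
    by move=> /andP[/negP h1 h2].
  by move=> [h1 /negP h2]; apply/andP.
have AB : EA `<=` EB.
  move=> w /leq_trans; apply; rewrite leq_double; apply: subset_leq_card.
  apply/fintype.subsetP => i; rewrite !inE /bA /bB => /ltW h; apply: (le_trans h).
  by rewrite ler_pM2r//; lra.
rewrite measureD//; last by rewrite ltey_eq fin_num_measure.
rewrite setIidr// [X in (_ - X)%E]PEA [X in (X - _)%E]PEB -EFinB lee_fin.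
apply: (le_trans (majority_gap_ge t eta01)).
have /andP[eta0 eta1] := eta01.
apply: lerB; apply: binom_expect_mono => //; try lra; exact: majority_mono.
Qed.

Theorem theorem9p6 (R : realType) :
  exists K : R, 0 < K /\
    forall (p eps delta : R) (t : nat),
      0 < p < 1 -> 0 < eps < 1 -> 0 < delta < 1 ->
      K * ln (1 / delta) / (p * eps) ^+ 4 <= t%:R ->
      forall (d : measure_display) (T : measurableType d)
        (P : probability T R) (X : 'I_t -> {RV P >-> R}),
        (forall i, has_law (X i) (stable_dist p)) ->
        mutually_independent X ->
        ((1 - delta)%:E <=
          P [set w | (1 - eps <=
               sample_median
                 (fun i => `|X i w| / median_abs (stable_dist p)) <=
               1 + eps)%R])%E.
Proof.
have [c /andP[c0 c2] hc] := stable_dist_near_median R.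
(* With [eta = c * (p * eps) ^+ 2], the bound on [t] then says [t * eta ^+ 2 >= ln (1 / delta)]. *)
exists (c ^+ 2)^-1; split; first by rewrite invr_gt0 exprn_gt0.
move=> p eps delta t p01 e01 /andP[d0 d1] ht d T P X lawX indX.
have [m0 hA hB] := hc p eps p01 e01.
have /andP[p0 p1] := p01; have /andP[e0 e1] := e01.
have pe0 : 0 < p * eps by rewrite mulr_gt0.
have pe1 : p * eps <= 1 by rewrite mulr_ile1// ltW.
have eta01 : 0 <= c * (p * eps) ^+ 2 <= 1 / 2.
  have : (p * eps) ^+ 2 <= 1 by rewrite expr_le1// ltW.
  have : 0 < (p * eps) ^+ 2 by rewrite exprn_gt0.
  by move=> h1 h2; apply/andP; split; nra.
have dle : expR (- (t%:R * (c * (p * eps) ^+ 2) ^+ 2)) <= delta.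
  rewrite -[leRHS]lnK ?posrE// ler_expR.
  move: ht; rewrite div1r lnV ?posrE// mulrAC -invfM ler_pdivrMl; last first.
    by rewrite mulr_gt0 ?exprn_gt0.
  rewrite (_ : c ^+ 2 * (p * eps) ^+ 4 * t%:R =
    t%:R * (c * (p * eps) ^+ 2) ^+ 2); last by ring.
  by lra.
(* For [t = 0] the previous bound would read [1 <= delta]. *)
have t0 : (0 < t)%N.
  rewrite lt0n; apply/negP => /eqP t0; move: dle.
  by rewrite t0 mul0r oppr0 expR0; lra.
apply: le_trans (sample_median_concentration t0 m0 (ltW e0) eta01 hA hB lawX indX).
by rewrite lee_fin lerB.
Qed.
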